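(* Let $M=\begin{pmatrix}A&B\\0&C\end{pmatrix}$ be the real $(m+2)\times(m+2)$ matrix described in the context, built from $r>0$, a grid $0=s_0<s_1<\dots<s_{m+2}=S$ with $h_{m+2}=s_{m+2}-s_{m+1}$, and real numbers $\alpha_j,\beta_j,\gamma_j$. Suppose that $$rI+A \text{ is invertible},\qquad \mu_\infty[rI+A]\le 0,\qquad r+\alpha_m+|\beta_m|+|\gamma_m|\le 0.$$ Then for all $t\ge 0$ $$e^{-rt}+\left(1-e^{-rt}\right)\frac{2S}{h_{m+2}}\ \le\ \|e^{tM}\|_\infty\ \le\ e^{-rt}+\left(1+3e^{-rt}\right)\frac{2S}{h_{m+2}}.$$
   Context: Let $m\ge 2$ be an integer, let $r>0$ and $S>0$ be real, and let $0=s_0<s_1<\dots<s_{m+1}<s_{m+2}=S$ be a (possibly non-uniform) grid with mesh widths $h_j=s_j-s_{j-1}$. $A$ is the real $m\times m$ tridiagonal matrix with diagonal entries $\alpha_1,\dots,\alpha_m$, subdiagonal entries $\beta_2,\dots,\beta_m$ ($\beta_i$ in position $(i,i-1)$) and superdiagonal entries $\gamma_1,\dots,\gamma_{m-1}$ ($\gamma_i$ in position $(i,i+1)$), all given real numbers. $B$ is the real $m\times 2$ matrix whose only possibly nonzero entry is a given real number $\gamma_m$ in position $(m,1)$. $C$ is the $2\times 2$ matrix $$C=\frac{r}{h_{m+2}}\begin{pmatrix}-S & s_{m+1}\\ -S& s_{m+1}\end{pmatrix}.$$ $M$ is the block matrix $\begin{pmatrix}A&B\\0&C\end{pmatrix}$.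 $\|\cdot\|_\infty$ is the matrix norm induced by the maximum norm (maximum absolute row sum). $I$ is the identity matrix of the appropriate size. The logarithmic maximum norm of a square matrix $X$ is $\mu_\infty[X]=\lim_{t\downarrow 0}\frac{\|I+tX\|_\infty-1}{t}=\max_i\{\xi_{ii}+\sum_{j\ne i}|\xi_{ij}|\}$, where $X=(\xi_{ij})$. *)

(* Defs.v *)
From HB Require Import structures.
From mathcomp Require Import all_boot all_order all_algebra.
From mathcomp Require Import all_classical all_reals all_analysis.
Set Implicit Arguments.
Unset Strict Implicit.
Unset Printing Implicit Defensive.
Import Order.TTheory GRing.Theory Num.Theory.
Import numFieldNormedType.Exports.

Local Open Scope classical_set_scope.
Local Open Scope ring_scope.

(* The library norm on column vectors is the maximum norm. *)
Definition mx_norm_inf (R : realType) (n : nat) (X : 'M[R]_n) : R :=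
  sup [set `|X *m v| | v in [set v : 'cV[R]_n | `|v| <= 1]].

Definition lognorm_inf (R : realType) (n : nat) (X : 'M[R]_n) : R :=
  lim ((mx_norm_inf (1%:M + t *: X) - 1) / t @[t --> 0^'+]).

Definition mx_exp (R : realType) (n : nat) (X : 'M[R]_n) : 'M[R]_n :=
  limn (series (fun k : nat => (k`!%:R)^-1 *: X ^+ k)).

Section BlockMatrix.
Variables (R : realType) (m : nat).

Definition mesh_width (s : nat -> R) (j : nat) : R := s j - s j.-1.

(* The coefficient sequences are indexed from 1, the matrix entries from 0. *)
Definition mxA (alpha beta gamma : nat -> R) : 'M[R]_m :=
  \matrix_(i < m, j < m)
    if i == j :> nat then alpha i.+1
    else if i == j.+1 :> nat then beta i.+1
    else if j == i.+1 :> nat then gamma i.+1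
    else 0.

Definition mxB (gamma : nat -> R) : 'M[R]_(m, 2) :=
  \matrix_(i < m, j < 2)
    if (i.+1 == m) && (j == 0 :> nat) then gamma m else 0.

Definition mxC (r S : R) (s : nat -> R) : 'M[R]_2 :=
  (r / mesh_width s m.+2) *:
    \matrix_(i < 2, j < 2) if j == 0 :> nat then - S else s m.+1.

Definition mxM (r S : R) (s alpha beta gamma : nat -> R) : 'M[R]_(m + 2) :=
  block_mx (mxA alpha beta gamma) (mxB gamma) 0 (mxC r S s).

End BlockMatrix.

(* Main.v *)
(* Since [C 1 = - r 1] and the range of [C] is spanned by [1], a vector [y] of
   the lower block splits as [p + q] with [C p = 0] and [C q = - r q].  Solving
   [A z + B p = 0] and [(r + A) w + B q = 0] extends [p] and [q] to eigenvectors
   of [M], so that [e^(tM)] maps [(x, y)] to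
   [(z + e^(-rt) w + e^(tA) (x - z - w), p + e^(-rt) q)].
   The sign of the logarithmic norm says that [r + A] is weakly diagonally
   dominant with nonpositive diagonal; this bounds [z] and [w] by [p] and [q],
   and it gives [|e^(tA)| <= e^(-rt)] through Euler's formula
   [e^X = lim (1 + X / N)^N].  The lower bound is attained on the last row, for
   the vector [x = 0], [y = (-1, 1)]. *)
Require Import Defs.
From mathcomp Require Import all_boot all_order all_algebra.
From mathcomp Require Import all_classical all_reals all_analysis.
From mathcomp Require Import ring lra.
Import Order.TTheory GRing.Theory Num.Theory.
Import numFieldNormedType.Exports.

Set Implicit Arguments.
Unset Strict Implicit.

Local Open Scope ring_scope.

(** * Maximum norm, logarithmic norm and diagonal dominance *)

Section MaxNorm.
Variables (R : realType) (n : nat).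
Implicit Types (X : 'M[R]_n) (v : 'cV[R]_n) (K : R).

Lemma normcv_le v K : 0 <= K -> (forall i, `|v i 0| <= K) -> `|v| <= K.
Proof.
move=> K0 vK; rewrite [leLHS]/Num.Def.normr /= mx_normrE.
by apply/bigmax_leP; split=> // -[i j] _ /=; rewrite ord1.
Qed.

Lemma ler_normcv v i : `|v i 0| <= `|v|.
Proof.
by rewrite [leRHS]/Num.Def.normr /= mx_normrE; apply/bigmax_geP; right; exists (i, 0).
Qed.

Lemma ler_norm_mulmxcv X v i :
  `|(X *m v) i 0| <= (\sum_j `|X i j|) * `|v|.
Proof.
rewrite mxE mulr_suml; apply: le_trans (ler_norm_sum _ _ _) _.
by apply: ler_sum => j _; rewrite normrM ler_wpM2l // ler_normcv.
Qed.

Lemma ler_normmx_sum X v : `|X *m v| <= (\sum_i \sum_j `|X i j|) * `|v|.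
Proof.
apply: normcv_le => [|i].
  by rewrite mulr_ge0 // !sumr_ge0 // => ? _; rewrite sumr_ge0.
apply: le_trans (ler_norm_mulmxcv _ _ _) _; rewrite ler_wpM2r //.
by rewrite [leRHS](bigD1 i) //= lerDl !sumr_ge0 // => ? _; rewrite sumr_ge0.
Qed.

Lemma mx_norm_inf_le X K :
  (forall v, `|v| <= 1 -> `|X *m v| <= K) -> mx_norm_inf X <= K.
Proof.
move=> XK; apply: ge_sup; first by exists `|X *m (0 : 'cV_n)|, 0; rewrite //= normr0.
by move=> _ [v v1 <-]; exact: XK.
Qed.

Lemma le_mx_norm_inf X v : `|v| <= 1 -> `|X *m v| <= mx_norm_inf X.
Proof.
move=> v1; apply: sup_upper_bound; last by exists v.
split; first by exists `|X *m v|, v.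
exists (\sum_i \sum_j `|X i j|) => _ [w /= w1 <-].
apply: le_trans (ler_normmx_sum _ _) _; rewrite ler_piMr //.
by rewrite sumr_ge0 // => ? _; rewrite sumr_ge0.
Qed.

(** The sign vector of row [i] lies in the unit ball and attains the row sum. *)
Lemma rowsum_le_mx_norm_inf X i : \sum_j `|X i j| <= mx_norm_inf X.
Proof.
pose v : 'cV[R]_n := \col_j Num.sg (X i j).
have v1 : `|v| <= 1.
  by apply: normcv_le => // j; rewrite mxE normr_sg; case: (_ != _).
apply: le_trans (le_mx_norm_inf X v1); apply: le_trans (ler_normcv _ i).
rewrite mxE [X in _ <= `|X|](eq_bigr (fun j => `|X i j|)) => [|j _].
  exact: ler_norm.
by rewrite mxE mulrC -normrEsg.
Qed.

Lemma mx_norm_inf_le_rowsum X K : (0 < n)%N -> (forall i, \sum_j `|X i j| <= K) ->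
  mx_norm_inf X <= K.
Proof.
move=> n0 XK; apply: mx_norm_inf_le => v v1.
have K0 : 0 <= K by apply: le_trans (XK (Ordinal n0)); rewrite sumr_ge0.
apply: normcv_le => // i; apply: le_trans (ler_norm_mulmxcv _ _ _) _.
by rewrite -[leRHS]mulr1 ler_pM // sumr_ge0.
Qed.

(** For such small [t] the diagonal entry [1 + t * X i i] is nonnegative, so its absolute value
    opens and the row sum is affine in [t]. *)
Lemma rowsum_1D X (t : R) i : 0 <= t -> t * `|X i i| <= 1 ->
  \sum_j `|(1%:M + t *: X) i j| = 1 + t * (X i i + \sum_(j | j != i) `|X i j|).
Proof.
move=> t0 tX; rewrite (bigD1 i) //= !mxE eqxx mulr1n mulrDr addrA; congr (_ + _).
  rewrite ger0_norm //.
  have := ler_norm (- X i i); rewrite normrN => h.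
  have : t * (- X i i) <= t * `|X i i| by rewrite ler_wpM2l.
  lra.
rewrite mulr_sumr; apply: eq_bigr => j ji.
by rewrite !mxE eq_sym (negPf ji) add0r normrM ger0_norm.
Qed.

(** The difference quotient defining the logarithmic norm is constant near [0]: for small [t] one
    row [k], the one maximizing [rho], carries the norm. *)
Lemma rowsum_le_lognorm_inf X i :
  X i i + \sum_(j | j != i) `|X i j| <= lognorm_inf X.
Proof.
pose rho k := X k k + \sum_(j | j != k) `|X k j|.
case: (@arg_maxP _ _ _ i predT rho isT) => k _ kmax.
suff -> : lognorm_inf X = rho k by exact: kmax.
apply: cvg_lim => //; apply: cvg_near_cst.
(* Up to [d^-1], [t] is small enough for all rows at once. *)
pose d := 1 + \sum_l `|X l l|.
have d0 : 0 < d by rewrite ltr_pwDl // sumr_ge0.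
near=> t.
have t0 : 0 < t by [].
have tX l : t * `|X l l| <= 1.
  have : t <= d^-1 by near: t; apply: nbhs_right_le; rewrite invr_gt0.
  rewrite -(ler_pM2r d0) mulVf ?gt_eqF // => /(le_trans _); apply.
  rewrite ler_wpM2l ?ltW // /d (bigD1 l) //=.
  have : 0 <= \sum_(i0 | i0 != l) `|X i0 i0| by rewrite sumr_ge0.
  lra.
have -> : mx_norm_inf (1%:M + t *: X) = 1 + t * rho k.
  apply/le_anti/andP; split.
    apply: mx_norm_inf_le_rowsum; first by apply: leq_ltn_trans (ltn_ord i).
    by move=> l; rewrite rowsum_1D ?(ltW t0) // lerD2l ler_wpM2l ?(ltW t0) //; exact: kmax.
  by rewrite -rowsum_1D ?(ltW t0) //; exact: rowsum_le_mx_norm_inf.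
by rewrite addrAC subrr add0r mulrAC divff ?mul1r // gt_eqF.
Unshelve. all: by end_near. Qed.

Lemma rowsum_lognorm_inf_le X (mu : R) i : lognorm_inf X <= mu ->
  \sum_(j | j != i) `|X i j| <= mu - X i i.
Proof.
by move=> Xmu; have := le_trans (rowsum_le_lognorm_inf X i) Xmu; lra.
Qed.

(** In a row [k] where [v] has maximal modulus, the off-diagonal terms are at most their row sum
    times [|v k 0|], so dominance leaves at least [d k * |v k 0|]. *)
Lemma diag_dominant_bound X (d : 'I_n -> R) v K :
    (forall i, 0 < d i) ->
    (forall i, d i + \sum_(j | j != i) `|X i j| <= `|X i i|) -> 0 <= K ->
    (forall i, `|(X *m v) i 0| <= d i * K) ->
  `|v| <= K.
Proof.
move=> d0 domX K0 vK; apply: normcv_le => // i.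
case: (@arg_maxP _ _ _ i predT (fun l => `|v l 0|) isT) => k _ kmax.
apply: le_trans (kmax i isT) _; rewrite -(ler_pM2l (d0 k)).
apply: le_trans (vK k); rewrite mxE (bigD1 k) //=.
set s := \sum_(j | j != k) _.
have sv : `|s| <= (\sum_(j | j != k) `|X k j|) * `|v k 0|.
  rewrite mulr_suml; apply: le_trans (ler_norm_sum _ _ _) _.
  by apply: ler_sum => j _; rewrite normrM ler_wpM2l //; exact: kmax.
have := ler_wpM2r (normr_ge0 (v k 0)) (domX k); rewrite mulrDl -normrM => h.
have := lerB_normD (X k k * v k 0) s.
lra.
Qed.

(** The preceding bound with [K = 0], the weights being the dominance gaps, kills every kernel
    vector. *)
Lemma diag_dominant_unitmx X :
    (forall i, \sum_(j | j != i) `|X i j| < `|X i i|) -> X \in unitmx.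
Proof.
move=> domX; rewrite -unitmx_tr -row_free_unit; apply: inj_row_free => u uX.
apply: trmx_inj; rewrite trmx0; apply/eqP; rewrite -normr_le0.
apply: (@diag_dominant_bound X
  (fun i => `|X i i| - \sum_(j | j != i) `|X i j|)) => // i.
- by rewrite subr_gt0.
- by rewrite subrK.
- by rewrite -[X]trmxK -trmx_mul uX trmx0 mxE normr0 mulr0.
Qed.

(* Strict dominance holds for [X - eps], whose solution has the same right-hand
   side and differs from [v] by [eps * X^-1] applied to a bounded vector. *)
Lemma weak_diag_dominant_bound X (d : 'I_n -> R) v K :
    X \in unitmx -> (forall i, 0 <= d i) ->
    (forall i, d i + \sum_(j | j != i) `|X i j| <= - X i i) -> 0 <= K ->
    (forall i, `|(X *m v) i 0| <= d i * K) ->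
  `|v| <= K.
Proof.
move=> Xu d0 domX K0 vK.
pose L := \sum_i \sum_j `|invmx X i j|.
have L0 : 0 <= L by rewrite sumr_ge0 // => ? _; rewrite sumr_ge0.
suff H e : 0 < e -> `|v| <= K + e * (L * K).
  (* This shift keeps the error below [e]; the [+ 1] covers the case [L * K = 0]. *)
  apply/ler_addgt0Pr => e e0; apply: le_trans (H (e / (L * K + 1)) _) _.
    by rewrite divr_gt0 // ltr_wpDl // mulr_ge0.
  rewrite lerD2l mulrAC ler_pdivrMr ?ler_pM2l //.
    by rewrite lerDl.
  by rewrite ltr_wpDl // mulr_ge0.
move=> e0; pose Y := X - e%:M.
(* The diagonal of [X] is nonpositive, so the shift enlarges its modulus by exactly [e] and turns
   the weights [d i] into positive ones. *)
have Yii i : `|Y i i| = - X i i + e.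
  rewrite !mxE eqxx mulr1n ler0_norm; first by rewrite opprB addrC.
  have := domX i; have := d0 i.
  have : 0 <= \sum_(j | j != i) `|X i j| by rewrite sumr_ge0.
  lra.
have Yij i : \sum_(j | j != i) `|Y i j| = \sum_(j | j != i) `|X i j|.
  by apply: eq_bigr => j ji; rewrite !mxE eq_sym (negPf ji) mulr0n subr0.
have Yu : Y \in unitmx.
  apply: diag_dominant_unitmx => i; rewrite Yii Yij.
  by have := domX i; have := d0 i; lra.
pose w := invmx Y *m (X *m v).
have Yw : Y *m w = X *m v by rewrite mulKVmx.
have wK : `|w| <= K.
  apply: (@diag_dominant_bound Y (fun i => d i + e)) => // i.
  - by rewrite ltr_wpDl.
  - by rewrite Yii Yij; have := domX i; lra.
  - rewrite Yw; apply: le_trans (vK i) _.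
    by rewrite ler_wpM2r // lerDl ltW.
have vw : v = w - e *: (invmx X *m w).
  rewrite -[LHS](mulKmx Xu) -Yw mulmxBl mulmxBr mulKmx //.
  by rewrite mul_scalar_mx -scalemxAr.
rewrite vw; apply: le_trans (ler_normB _ _) _; apply: lerD => //.
rewrite mx_normZ gtr0_norm // ler_pM2l //.
by apply: le_trans (ler_normmx_sum _ _) _; rewrite ler_wpM2l.
Qed.

End MaxNorm.

(** * The matrix exponential: convergence and Euler's formula *)

Section MatrixExponential.
Variables (R : realType) (n : nat).
Implicit Types (X : 'M[R]_n) (v : 'cV[R]_n) (K : R).
Local Open Scope classical_set_scope.

Lemma exprZmx (a : R) X k : (a *: X) ^+ k = a ^+ k *: X ^+ k.
Proof.
elim: k => [|k IH]; first by rewrite !expr0 scale1r.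
by rewrite !exprS IH -!mulmxE -scalemxAl -scalemxAr scalerA.
Qed.

Lemma normr_mulmx_exp X K v k : 0 <= K ->
  (forall w : 'cV[R]_n, `|X *m w| <= K * `|w|) ->
  `|X ^+ k *m v| <= K ^+ k * `|v|.
Proof.
move=> K0 XK; elim: k v => [|k IH] v; first by rewrite !expr0 mul1mx mul1r.
rewrite exprSr -mulmxE -mulmxA; apply: le_trans (IH _) _.
by rewrite exprSr -mulrA ler_wpM2l // exprn_ge0.
Qed.

Lemma is_cvg_mx_cvg (u : nat -> 'M[R]_n) :
  (forall i j, cvgn (fun N => u N i j)) -> cvgn u.
Proof.
move=> cu; apply/cvg_ex; exists (\matrix_(i, j) limn (fun N => u N i j)).
apply/cvgrPdist_le => e e0.
have : \forall N \near \oo, forall ij : 'I_n * 'I_n,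
    `|limn (fun N => u N ij.1 ij.2) - u N ij.1 ij.2| <= e.
  by apply: filter_forall => -[i j] /=; move/cvgrPdist_le: (cu i j) => /(_ _ e0).
apply: filterS => N uN; rewrite [leLHS]/Num.Def.normr /= mx_normrE.
apply/bigmax_leP; split; first exact: ltW.
by move=> [i j] _; have := uN (i, j); rewrite !mxE.
Qed.

(** With [K] the sum of the moduli of all entries of [X], the entries of [X ^+ k] are at most
    [K ^+ k], so the scalar exponential series at [K] dominates. *)
Lemma mx_exp_coef_cvg X i j :
  \sum_(0 <= k < N) (k`!%:R)^-1 * (X ^+ k) i j @[N --> \oo] --> mx_exp X i j.
Proof.
have serE i1 j1 N : series (fun k => (k`!%:R)^-1 *: X ^+ k) N i1 j1 =
    \sum_(0 <= k < N) (k`!%:R)^-1 * (X ^+ k) i1 j1.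
  by rewrite /series /= summxE; apply: eq_bigr => k _; rewrite mxE.
have cv : cvgn (series (fun k => (k`!%:R)^-1 *: X ^+ k)).
  apply: is_cvg_mx_cvg => i1 j1; under eq_fun do rewrite serE.
  pose K := \sum_i \sum_j `|X i j|.
  have K0 : 0 <= K by rewrite sumr_ge0 // => ? _; rewrite sumr_ge0.
  apply: (@normed_cvg _ R); apply: series_le_cvg (is_cvg_series_exp_coeff K).
  - by move=> k; exact: normr_ge0.
  - by move=> k; exact: exp_coeff_ge0.
  move=> k; rewrite /exp_coeff /= normrM mulrC normfV normr_nat.
  rewrite ler_wpM2r ?invr_ge0 //.
  have -> : (X ^+ k) i1 j1 = (X ^+ k *m delta_mx j1 0 : 'cV_n) i1 0.
    by rewrite -colE mxE.
  apply: le_trans (ler_normcv _ _) _.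
  apply: le_trans (normr_mulmx_exp _ _ K0 (@ler_normmx_sum _ _ X)) _.
  rewrite ler_piMr ?exprn_ge0 //; apply: normcv_le => // l.
  by rewrite mxE normr_nat lern1 leq_b1.
have := cvg_comp _ _ cv (@coord_continuous _ n n i j (mx_exp X)).
rewrite (_ : _ \o _ = fun N => \sum_(0 <= k < N) (k`!%:R)^-1 * (X ^+ k) i j) //.
by apply/funext => N; exact: serE.
Qed.

Lemma mx_exp_mulcv_cvg X v i :
  \sum_(0 <= k < N) (k`!%:R)^-1 * (X ^+ k *m v) i 0 @[N --> \oo]
    --> (mx_exp X *m v) i 0.
Proof.
rewrite [X in _ --> X]mxE.
rewrite (_ : (fun N => _) = fun N =>
  \sum_j (\sum_(0 <= k < N) (k`!%:R)^-1 * (X ^+ k) i j) * v j 0).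
  apply: cvg_big => [|j _]; first exact: add_continuous.
  by apply: cvgMl; exact: mx_exp_coef_cvg.
apply/funext => N; under [RHS]eq_bigr do rewrite mulr_suml.
rewrite exchange_big; apply: eq_bigr => k _.
by rewrite mxE mulr_sumr; apply: eq_bigr => j _; rewrite mulrA.
Qed.

Lemma mx_exp_eigen X v (a : R) : X *m v = a *: v ->
  mx_exp X *m v = expR a *: v.
Proof.
move=> Xv; have Xkv k : X ^+ k *m v = a ^+ k *: v.
  elim: k => [|k IH]; first by rewrite !expr0 mul1mx scale1r.
  by rewrite exprSr -mulmxE -mulmxA Xv -scalemxAr IH scalerA exprS.
apply/colP => i; rewrite [RHS]mxE.
rewrite -(cvg_lim _ (@mx_exp_mulcv_cvg X v i)) //; apply: cvg_lim => //.
rewrite (_ : (fun N => _) = fun N => series (exp_coeff a) N * v i 0).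
  by apply: cvgMl; exact: is_cvg_series_exp_coeff.
apply/funext => N; rewrite /series /= mulr_suml; apply: eq_bigr => k _.
by rewrite Xkv mxE mulrA [_^-1 * _]mulrC.
Qed.

(** Inverting [1 - x <= expR (- x)] at [x = y / (1 + y)] gives [expR x <= 1 + y]; then take the
    power [N.+1]. The left side tends to [expR K], so this controls the error in Euler's formula. *)
Lemma expR_lower_compound K (N : nat) : 0 <= K ->
  expR (K / (1 + K * N.+1%:R^-1)) <= (1 + K * N.+1%:R^-1) ^+ N.+1.
Proof.
move=> K0; set y := K * N.+1%:R^-1.
have y0 : 0 <= y by rewrite mulr_ge0 ?invr_ge0.
have -> : K / (1 + y) = y / (1 + y) * N.+1%:R.
  by rewrite mulrAC /y -[K * _ * _]mulrA mulVf ?mulr1.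
have y1 : 0 < 1 + y by rewrite ltr_pwDl.
rewrite expRM_natr lerXn2r ?nnegrE ?expR_ge0 ?(ltW y1) //.
rewrite -[leLHS]invrK -[leRHS]invrK -expRN lef_pV2 ?posrE ?expR_gt0 ?invr_gt0 //.
apply: le_trans (expR_ge1Dx _).
rewrite [leLHS](_ : _ = 1 - y / (1 + y)) //.
by field; rewrite gt_eqF.
Qed.

Lemma ffact_le_expn N k : (N ^_ k <= N ^ k)%N.
Proof.
elim: k => [|k IH]; first by rewrite ffactn0.
by rewrite ffactnSr expnSr leq_mul // leq_subr.
Qed.

(* All the coefficients [1/k! - C(N,k)/N^k] of the difference between the
   exponential series and the compound power are nonnegative, so this
   difference is dominated by the same difference at the scalar [K]. *)
Lemma compound_mx_dist X K v N i : 0 <= K ->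
    (forall w : 'cV[R]_n, `|X *m w| <= K * `|w|) ->
  `|\sum_(0 <= k < N.+2) (k`!%:R)^-1 * (X ^+ k *m v) i 0
     - ((1%:M + N.+1%:R^-1 *: X) ^+ N.+1 *m v) i 0|
    <= (expR K - expR (K / (1 + K * N.+1%:R^-1))) * `|v|.
Proof.
move=> K0 XK; set h : R := N.+1%:R^-1.
pose c k : R := (k`!%:R)^-1 - 'C(N.+1, k)%:R * h ^+ k.
have c0 k : 0 <= c k.
  rewrite subr_ge0 exprVn -natrX ler_pdivrMr ?ltr0n ?expn_gt0 //.
  rewrite mulrC ler_pdivlMr ?ltr0n ?fact_gt0 // -natrM bin_ffact ler_nat.
  exact: ffact_le_expn.
have binE : (1%:M + h *: X) ^+ N.+1 =
    \sum_(0 <= k < N.+2) ('C(N.+1, k)%:R * h ^+ k) *: X ^+ k.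
  have -> : 1%:M = 1 :> 'M[R]_n by [].
  rewrite addrC exprD1n big_mkord; apply: eq_bigr => k _.
  by rewrite exprZmx scalerMnl mulr_natl.
have -> : \sum_(0 <= k < N.+2) (k`!%:R)^-1 * (X ^+ k *m v) i 0
     - ((1%:M + h *: X) ^+ N.+1 *m v) i 0
  = \sum_(0 <= k < N.+2) c k * (X ^+ k *m v) i 0.
  rewrite binE mulmx_suml summxE -sumrB; apply: eq_bigr => k _.
  by rewrite -scalemxAl [in X in _ - X = _]mxE -mulrBl.
apply: (@le_trans _ _ (\sum_(0 <= k < N.+2) c k * (K ^+ k * `|v|))).
  apply: le_trans (ler_norm_sum _ _ _) _; apply: ler_sum => k _.
  rewrite normrM ger0_norm // ler_wpM2l //.
  by apply: le_trans (ler_normcv _ _) _; exact: normr_mulmx_exp.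
under eq_bigr do rewrite mulrA; rewrite -mulr_suml ler_wpM2r //.
(* The first sum is a partial sum of the series of [expR K]; the second is the full binomial
   expansion of the scalar compound power. *)
under eq_bigr do rewrite mulrBl; rewrite sumrB; apply: lerB.
  rewrite [leRHS]/expR.
  have := nondecreasing_cvgn_le _ (is_cvg_series_exp_coeff K) N.+2.
  rewrite {1}/series /=; under eq_bigr do rewrite mulrC; apply.
  by apply: nondecreasing_series => k _ _; exact: exp_coeff_ge0.
apply: le_trans (expR_lower_compound N K0) _.
rewrite -/h addrC exprD1n big_mkord le_eqVlt; apply/orP; left; apply/eqP.
by apply: eq_bigr => k _; rewrite exprMn -mulr_natl mulrA mulrAC -mulrA mulrC -mulrA.
Qed.

(** Powers of the one-step bound satisfy [(1 - b / N) ^+ N <= expR (- b)], and by Euler's formula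
    this passes to the limit. *)
Lemma mx_exp_contract X K (b : R) v : 0 <= K ->
    (forall w : 'cV[R]_n, `|X *m w| <= K * `|w|) ->
    (\forall N \near \oo, forall w : 'cV[R]_n,
       `|(1%:M + N.+1%:R^-1 *: X) *m w| <= (1 - b / N.+1%:R) * `|w|) ->
  `|mx_exp X *m v| <= expR (- b) * `|v|.
Proof.
move=> K0 XK Xb; apply: normcv_le => [|i]; first by rewrite mulr_ge0 ?expR_ge0.
pose g N : R := (expR K - expR (K / (1 + K * N.+1%:R^-1))) * `|v|
  + expR (- b) * `|v|.
have cg : g @ \oo --> expR (- b) * `|v|.
  rewrite -[X in _ --> X]add0r; apply: cvgD; last exact: cvg_cst.
  rewrite -[X in _ --> X](mul0r `|v|); apply: cvgMl.
  rewrite -(subrr (expR K)); apply: cvgB; first exact: cvg_cst.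
  apply: continuous_cvg; first exact: continuous_expR.
  rewrite -[X in _ --> X]divr1; apply: cvgM; first exact: cvg_cst.
  apply: cvgV => //; rewrite -[X in _ --> X]addr0; apply: cvgD.
    exact: cvg_cst.
  rewrite -(mulr0 K); apply: cvgMr; exact: cvg_harmonic.
have cf : `|\sum_(0 <= k < N.+2) (k`!%:R)^-1 * (X ^+ k *m v) i 0| @[N --> \oo]
    --> `|(mx_exp X *m v) i 0|.
  (* The two shifts match the [N.+2] terms of the expansion of a power [N.+1]. *)
  apply: cvg_norm; have := @mx_exp_mulcv_cvg X v i.
  by rewrite -cvg_shiftS -cvg_shiftS.
apply: ler_cvg_to cf cg _; apply: filterS2 Xb (nbhs_infty_gtr b) => N XbN bN.
(* Powers are monotone only on nonnegative bases, hence the restriction to [N > b]. *)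
have b0 : 0 <= 1 - b / N.+1%:R.
  rewrite subr_ge0 ler_pdivrMr // mul1r; apply: le_trans (ltW bN) _.
  by rewrite ler_nat.
have le1 : `|((1%:M + N.+1%:R^-1 *: X) ^+ N.+1 *m v) i 0| <= expR (- b) * `|v|.
  apply: le_trans (ler_normcv _ _) _.
  apply: le_trans (normr_mulmx_exp _ _ b0 XbN) _; rewrite ler_wpM2r //.
  have -> : - b = - (b / N.+1%:R) * N.+1%:R.
    by rewrite mulNr -mulrA mulVf ?mulr1 // pnatr_eq0.
  by rewrite expRM_natr lerXn2r ?nnegrE ?expR_ge0 // expR_ge1Dx.
have := compound_mx_dist v N i K0 XK; rewrite /g => le2.
set P := _ i 0 in le1 le2; set Q := \sum_(_ <= _ < _) _ in le2 *.
have := ler_normD (Q - P) P; rewrite subrK; lra.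
Qed.

End MatrixExponential.

(** The hypothesis is a logarithmic norm at most [- r], written row by row. For large [N] each
    absolute row sum of [1 + t X / N.+1] is then at most [1 - r t / N.+1]. *)
Lemma mx_exp_decay (R : realType) (n : nat) (X : 'M[R]_n) (r t : R)
    (v : 'cV[R]_n) :
    0 <= t -> (forall i, \sum_(j | j != i) `|X i j| <= - r - X i i) ->
  `|mx_exp (t *: X) *m v| <= expR (- (r * t)) * `|v|.
Proof.
move=> t0 domX.
apply: (@mx_exp_contract _ _ _ (\sum_i \sum_j `|(t *: X) i j|)) => [|w|].
- by rewrite sumr_ge0 // => ? _; rewrite sumr_ge0.
- exact: ler_normmx_sum.
apply: filterS2 (nbhs_infty_gtr (t * \sum_i `|X i i|))
  (nbhs_infty_gtr (r * t)) => N XN rtN w; have N0 : 0 < N.+1%:R :> R by [].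
have leN : N%:R <= N.+1%:R :> R by rewrite ler_nat.
have b0 : 0 <= 1 - r * t / N.+1%:R.
  by rewrite subr_ge0 ler_pdivrMr // mul1r; exact: le_trans (ltW rtN) leN.
apply: normcv_le => [|i]; first by rewrite mulr_ge0.
rewrite scalerA; apply: le_trans (ler_norm_mulmxcv _ _ _) _.
rewrite ler_wpM2r // rowsum_1D.
- rewrite lerD2l (_ : - (r * t / _) = N.+1%:R^-1 * t * - r).
    by rewrite ler_wpM2l ?mulr_ge0 ?invr_ge0 //; have := domX i; lra.
  by rewrite mulrN [r * t]mulrC mulrAC [t / _]mulrC.
- by rewrite mulr_ge0 ?invr_ge0.
- rewrite -mulrA mulrC ler_pdivrMr // mul1r.
  apply: le_trans (le_trans (ltW XN) leN); rewrite ler_wpM2l //.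
  by rewrite [leRHS](bigD1 i) //= lerDl sumr_ge0.
Qed.

(** * Exponentials of block triangular matrices *)

Section BlockTriangular.
Variables (R : realType) (m p : nat).
Implicit Types (x z w : 'cV[R]_m) (y : 'cV[R]_p).

Lemma normcol_mx_le x y (K : R) : `|x| <= K -> `|y| <= K -> `|col_mx x y| <= K.
Proof.
move=> xK yK; apply: normcv_le => [|i]; first exact: le_trans xK.
case: (split_ordP i) => j ->; rewrite ?col_mxEu ?col_mxEd.
  exact: le_trans (ler_normcv _ _) xK.
exact: le_trans (ler_normcv _ _) yK.
Qed.

Lemma ler_normcol_mxu x y : `|x| <= `|col_mx x y|.
Proof.
apply: normcv_le => // i; rewrite -(col_mxEu x y); exact: ler_normcv.
Qed.

Lemma ler_normcol_mxd x y : `|y| <= `|col_mx x y|.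
Proof.
apply: normcv_le => // i; rewrite -(col_mxEd x y); exact: ler_normcv.
Qed.

(** Vectors supported on the upper block form an invariant subspace, on which the block matrix acts
    as [A]. *)
Lemma mx_exp_ublock (A : 'M[R]_m) (B : 'M[R]_(m, p)) (D : 'M[R]_p) x :
  mx_exp (block_mx A B 0 D) *m col_mx x 0 = col_mx (mx_exp A *m x) 0.
Proof.
have powE k : block_mx A B 0 D ^+ k *m col_mx x 0 = col_mx (A ^+ k *m x) 0.
  elim: k x => [|k IH] x'; first by rewrite !expr0 !mul1mx.
  rewrite !exprSr -!mulmxE -!mulmxA mul_block_col !mulmx0 mul0mx !addr0.
  exact: IH.
apply/colP => i.
have := @mx_exp_mulcv_cvg _ _ (block_mx A B 0 D) (col_mx x 0) i.
under eq_fun do under eq_bigr do rewrite powE.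
move/cvg_lim => <- //; apply: cvg_lim => //.
case: (split_ordP i) => j ->; rewrite ?col_mxEu ?col_mxEd.
  under eq_fun do under eq_bigr do rewrite col_mxEu.
  exact: mx_exp_mulcv_cvg.
rewrite mxE; apply: cvg_near_cst; apply: nearW => N.
by rewrite big1 // => k _; rewrite col_mxEd mxE mulr0.
Qed.

(* [(z, y1)] and [(w, y2)] are eigenvectors for the eigenvalues [0] and [- r]. *)
Lemma mx_exp_block_split (A : 'M[R]_m) (B : 'M[R]_(m, p)) (D : 'M[R]_p) (r t : R)
    x z w y1 y2 :
    A *m z + B *m y1 = 0 -> D *m y1 = 0 ->
    A *m w + B *m y2 = - r *: w -> D *m y2 = - r *: y2 ->
  mx_exp (t *: block_mx A B 0 D) *m col_mx x (y1 + y2)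
  = col_mx (z + expR (- (r * t)) *: w + mx_exp (t *: A) *m (x - z - w))
      (y1 + expR (- (r * t)) *: y2).
Proof.
move=> Az Dy1 Aw Dy2.
have -> : col_mx x (y1 + y2)
    = col_mx z y1 + col_mx w y2 + col_mx (x - z - w) 0.
  by rewrite !add_col_mx addr0 -[x - z - w]addrA -opprD [_ + (x - _)]addrC subrK.
rewrite mulmxDr [X in X + _ = _]mulmxDr.
rewrite (@mx_exp_eigen _ _ _ (col_mx z y1) 0); last first.
  by rewrite -scalemxAl mul_block_col mul0mx add0r Az Dy1 col_mx0 scaler0 scale0r.
rewrite (@mx_exp_eigen _ _ _ (col_mx w y2) (- (r * t))); last first.
  rewrite -scalemxAl mul_block_col mul0mx add0r Aw Dy2 -scale_col_mx scalerA.
  by rewrite mulrN mulrC.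
rewrite scale_block_mx scaler0 mx_exp_ublock expR0 scale1r scale_col_mx.
by rewrite !add_col_mx addr0.
Qed.

End BlockTriangular.

(** * The last row of [A] and the blocks [B] and [C] *)

Section BoundaryBlocks.
Variables (R : realType) (m : nat).
Implicit Types (r S : R) (s alpha beta gamma : nat -> R).

Lemma mxB_mulcv gamma (y : 'cV[R]_2) i :
  (mxB m gamma *m y) i 0 = if i.+1 == m then gamma m * y 0 0 else 0.
Proof.
rewrite mxE !big_ord_recl big_ord0 !mxE /= andbT andbF mul0r !addr0.
by case: ifP => _; rewrite ?mul0r.
Qed.

Lemma mxA_lastrow alpha beta gamma (i : 'I_m) : i.+1 = m ->
  mxA m alpha beta gamma i i = alpha m /\
  \sum_(j | j != i) `|mxA m alpha beta gamma i j| <= `|beta m|.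
Proof.
move=> im; split; first by rewrite mxE eqxx im.
case: (posnP i) => [i0|i_gt0].
  rewrite big1 // => j ji; move: (ltn_ord j); rewrite -[X in (_ < X)%N]im i0.
  by rewrite ltnS leqn0 => /eqP j0; move/negP: ji; case; rewrite -val_eqE /= j0 i0.
have lti : (i.-1 < m)%N by apply: leq_ltn_trans (ltn_ord i); exact: leq_pred.
pose k := Ordinal lti.
have ki : k != i by rewrite -val_eqE /= neq_ltn prednK // ?leqnn.
rewrite (bigD1 k) //= big1 ?addr0 => [|j /andP[ji jk]].
  by rewrite mxE /= gtn_eqF ?prednK // eqxx im.
rewrite mxE eq_sym (_ : (j == i :> nat) = false); last exact: negbTE.
rewrite (_ : (i == j.+1 :> nat) = false); last first.
  apply/negbTE; apply: contra jk => /eqP ij.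
  by rewrite -val_eqE /= ij.
rewrite (_ : (j == i.+1 :> nat) = false) ?normr0 //.
by apply/negbTE; rewrite im neq_ltn ltn_ord.
Qed.

(** Both rows of [C] coincide, so the value does not depend on [i]. *)
Lemma mxC_mulcv r S s (y : 'cV[R]_2) i :
  (mxC m r S s *m y) i 0 = r / mesh_width s m.+2 * (s m.+1 * y 1 0 - S * y 0 0).
Proof.
rewrite -scalemxAl mxE; congr (_ * _).
rewrite mxE !big_ord_recl big_ord0 !mxE /= addr0 mulNr addrC.
by congr (_ * y _ _ - _); apply: val_inj.
Qed.

End BoundaryBlocks.

(** * The two bounds for [M] *)

Theorem theorem4 (R : realType) (m : nat) (hm : (2 <= m)%N)
    (r S : R) (hr : 0 < r) (hS : 0 < S)
    (s : nat -> R) (hs0 : s 0%N = 0) (hsS : s m.+2 = S)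
    (hs : forall j : nat, (j < m.+2)%N -> s j < s j.+1)
    (alpha beta gamma : nat -> R)
    (hinv : r%:M + mxA m alpha beta gamma \in unitmx)
    (hmu : lognorm_inf (r%:M + mxA m alpha beta gamma) <= 0)
    (hrow : r + alpha m + `|beta m| + `|gamma m| <= 0)
    (t : R) (ht : 0 <= t) :
  expR (- (r * t)) + (1 - expR (- (r * t))) * (2 * S / mesh_width s m.+2)
    <= mx_norm_inf (mx_exp (t *: mxM m r S s alpha beta gamma))
  /\ mx_norm_inf (mx_exp (t *: mxM m r S s alpha beta gamma))
    <= expR (- (r * t)) + (1 + 3 * expR (- (r * t))) * (2 * S / mesh_width s m.+2).
Proof.
set A := mxA m alpha beta gamma in hinv hmu *.
pose B := mxB m gamma; pose C := mxC m r S s.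
set h := mesh_width s m.+2; pose e := expR (- (r * t)); rewrite -/e.
have hE : h = S - s m.+1 by rewrite /h /mesh_width hsS.
have h0 : 0 < h by rewrite hE subr_gt0 -hsS hs.
have s1 : 0 <= s m.+1.
  have sle k : (k < m.+2)%N -> 0 <= s k.
    elim: k => [|k IH] km; first by rewrite hs0.
    by apply: le_trans (IH (ltnW km)) _; rewrite ltW // hs // ltnW.
  exact: sle.
have e0 : 0 <= e by exact: expR_ge0.
have e1 : e <= 1 by rewrite -expR0 ler_expR oppr_le0 mulr_ge0 // ltW.
have dom_rA i : \sum_(j | j != i) `|(r%:M + A) i j| <= - (r%:M + A) i i.
  by have := rowsum_lognorm_inf_le i hmu; rewrite sub0r.
have rAii i : (r%:M + A) i i = r + A i i by rewrite !mxE eqxx mulr1n.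
have rAij i : \sum_(j | j != i) `|(r%:M + A) i j| = \sum_(j | j != i) `|A i j|.
  by apply: eq_bigr => j ji; rewrite !mxE eq_sym (negPf ji) mulr0n add0r.
have domA i : \sum_(j | j != i) `|A i j| <= - r - A i i.
  by have := dom_rA i; rewrite rAii rAij opprD.
(* The row condition [hrow] leaves an extra gap [|gamma m|] in the last row, the only row that [B]
   feeds. *)
have dom_gamma (i : 'I_m) : i.+1 = m ->
    \sum_(j | j != i) `|A i j| <= - r - `|gamma m| - A i i.
  by move=> im; have [-> le_beta] := mxA_lastrow alpha beta gamma im; move: hrow; lra.
have A_unit : A \in unitmx.
  apply: diag_dominant_unitmx => i; have := domA i.
  by have := ler_norm (- A i i); rewrite normrN; lra.
(* [kappa] is chosen so that [C y] is [- r * kappa y] times the all-ones vector; it is [1] on that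
   vector because [S - s m.+1 = h]. *)
pose kappa (y : 'cV[R]_2) := (S * y 0 0 - s m.+1 * y 1 0) / h.
pose q y : 'cV[R]_2 := const_mx (kappa y).
pose p (y : 'cV[R]_2) : 'cV[R]_2 := y - q y.
have Cy y : C *m y = - r *: q y.
  apply/colP => i; rewrite mxC_mulcv !mxE /kappa -/h.
  by field; rewrite gt_eqF.
have Cq y : C *m q y = - r *: q y.
  rewrite Cy; congr (_ *: _); apply/colP => i.
  rewrite [LHS]mxE [RHS]mxE [LHS]/kappa !mxE -mulrBl -hE.
  by rewrite mulrAC divff ?gt_eqF // mul1r.
have Cp y : C *m p y = 0 by rewrite mulmxBr Cy Cq subrr.
pose z y : 'cV[R]_m := - (invmx A *m (B *m p y)).
pose w y : 'cV[R]_m := - (invmx (r%:M + A) *m (B *m q y)).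
have Az y : A *m z y + B *m p y = 0 by rewrite mulmxN mulKVmx // addNr.
have Aw y : A *m w y + B *m q y = - r *: w y.
  have : (r%:M + A) *m w y = - (B *m q y) by rewrite mulmxN mulKVmx.
  rewrite mulmxDl mul_scalar_mx => rAw; rewrite scaleNr -[B *m _]opprK -rAw.
  by rewrite opprD addrCA subrr addr0.
have split x y : mx_exp (t *: mxM m r S s alpha beta gamma) *m col_mx x y =
    col_mx (z y + e *: w y + mx_exp (t *: A) *m (x - z y - w y))
      (p y + e *: q y).
  rewrite -[X in col_mx x X](subrK (q y)).
  exact: (mx_exp_block_split _ _ (Az y) (Cp y) (Aw y) (Cq y)).
set D := 2 * S / h.
(* The constant is [(S + s m.+1) / h = (2 * S - h) / h]. *)
have kD (y : 'cV[R]_2) : `|y| <= 1 -> `|kappa y| <= D - 1.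
  move=> y1; rewrite normrM [`|h^-1|]gtr0_norm ?invr_gt0 // ler_pdivrMr //.
  rewrite mulrBl mul1r divfK ?gt_eqF // hE; apply: le_trans (ler_normB _ _) _.
  rewrite !normrM (gtr0_norm hS) (ger0_norm s1).
  have := ler_wpM2l (ltW hS) (le_trans (ler_normcv y 0) y1).
  have := ler_wpM2l s1 (le_trans (ler_normcv y 1) y1).
  lra.
split; last first.
  apply: mx_norm_inf_le => v v1; rewrite -[v]vsubmxK.
  have x1 := le_trans (ler_normcol_mxu (usubmx v) (dsubmx v)) _.
  have y1 := le_trans (ler_normcol_mxd (usubmx v) (dsubmx v)) _.
  rewrite vsubmxK in x1 y1; move: (x1 _ v1) (y1 _ v1) => {x1 y1}.
  move: (usubmx v) (dsubmx v) => x y x1 y1.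
  have D0 : 0 <= D - 1 by apply: le_trans (kD y y1).
  have zD : `|z y| <= D.
    (* The weights are the dominance gaps of [A]; the right-hand side lives in the last row, with
       modulus at most [|gamma m| * D]. *)
    apply: (@weak_diag_dominant_bound _ _ A
      (fun i => if i.+1 == m then r + `|gamma m| else r)) => //.
    - by move=> i; case: ifP => _; rewrite ?addr_ge0 // ltW.
    - move=> i; case: ifP => [/eqP im|_].
        by have := dom_gamma i im; lra.
      by have := domA i; lra.
    - by lra.
    - move=> i; rewrite mulmxN mulKVmx // mxE normrN mxB_mulcv.
      case: ifP => _; last by rewrite normr0 mulr_ge0 ?ltW //; lra.
      have pD : `|p y 0 0| <= D.
        rewrite !mxE; apply: le_trans (ler_normB _ _) _.
        by have := kD y y1; have := le_trans (ler_normcv y 0) y1; lra.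
      rewrite normrM; apply: ler_pM => //.
      by rewrite lerDr ltW.
  have wD : `|w y| <= D - 1.
    (* For [r + A] the gap may vanish off the last row; this is where weak dominance and the
       invertibility [hinv] enter. *)
    apply: (@weak_diag_dominant_bound _ _ (r%:M + A)
      (fun i => if i.+1 == m then `|gamma m| else 0)) => //.
    - by move=> i; case: ifP.
    - move=> i; rewrite rAij rAii; case: ifP => [/eqP im|_].
        by have := dom_gamma i im; lra.
      by have := domA i; lra.
    - move=> i; rewrite mulmxN mulKVmx // mxE normrN mxB_mulcv.
      case: ifP => _; last by rewrite normr0 mul0r.
      by rewrite normrM mxE ler_wpM2l // kD.
  rewrite split; apply: normcol_mx_le.
    (* Upper block: the total is at most [D + e * (D - 1) + e * (1 + D + (D - 1))]. *)
    apply: le_trans (ler_normD _ _) _.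
    have := mx_exp_decay (x - z y - w y) ht domA; rewrite -/e => le1.
    have := ler_normD (z y) (e *: w y); rewrite mx_normZ ger0_norm // => le2.
    have le3 := ler_normB (x - z y) (w y).
    have le4 := ler_normB x (z y).
    have := ler_wpM2l e0 (le_trans le3 (lerD le4 (lexx _))).
    have := ler_wpM2l e0 x1; have := ler_wpM2l e0 zD; have := ler_wpM2l e0 wD.
    lra.
  (* Lower block: the total is at most [1 + (1 - e) * (D - 1) = e + (1 - e) * D]. *)
  apply: normcv_le => [|i]; first by have := mulr_ge0 e0 D0; lra.
  have -> : (p y + e *: q y) i 0 = y i 0 - (1 - e) * kappa y.
    by rewrite !mxE; ring.
  apply: le_trans (ler_normB _ _) _; rewrite normrM ger0_norm ?subr_ge0 //.
  have := le_trans (ler_normcv y i) y1.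
  have := ler_wpM2l (_ : 0 <= 1 - e) (kD y y1); rewrite subr_ge0 => /(_ e1).
  have := mulr_ge0 e0 D0.
  lra.
(* Opposite signs give [kappa y = - (D - 1)], so the last coordinate [1 - (1 - e) * kappa y] equals
   the lower bound exactly. *)
pose y : 'cV[R]_2 := \col_i if i == 0 then - 1 else 1.
have y1 : `|y| <= 1.
  by apply: normcv_le => // i; rewrite mxE; case: ifP; rewrite ?normrN normr1.
have v1 : `|col_mx (0 : 'cV[R]_m) y| <= 1 by apply: normcol_mx_le; rewrite ?normr0.
apply: le_trans (le_mx_norm_inf _ v1).
rewrite split; apply: le_trans (ler_normcol_mxd _ _).
apply: le_trans (ler_normcv _ 1); apply: le_trans (ler_norm _).
rewrite /p /q !mxE /= /kappa !mxE /= le_eqVlt; apply/orP; left; apply/eqP.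
by rewrite /D hE; field; rewrite -hE gt_eqF.
Qed.
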